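(* Let $N\in\mathbb{N}$ be even and let $\delta\in\mathcal{D}_N^{0,2}$. Then the diagonal copula $E_\delta$ is a symmetric equidistant even shuffle with $N$ stripes, i.e. $E_\delta=C_{S_\pi}$ for some permutation $\pi$ of $\{1,\dots,N\}$, and the corresponding permutation $\pi$ is symmetric, bi-monotone and fulfills $I_\pi^0=\emptyset$.
   Context: $\lambda$ denotes Lebesgue measure on $[0,1]$. $\mathcal{D}$ is the set of diagonals of bivariate copulas, i.e. of all functions $\delta:[0,1]\to[0,1]$ with $\delta(0)=0$, $\delta(1)=1$, $\delta$ non-decreasing, $\delta$ Lipschitz with constant $2$, and $\delta(t)\le t$ for all $t$. For $\delta\in\mathcal{D}$ the diagonal copula $E_\delta$ is $$E_\delta(u,v)=\min\Bigl\{u,v,\tfrac{\delta(u)+\delta(v)}{2}\Bigr\},\quad u,v\in[0,1].$$ Let $I_N^i:=(\frac{i-1}{N},\frac iN)$. $\mathcal{D}_N^{0,2}$ is the set of all $\delta\in\mathcal{D}$ such that for each $i\in\{1,\dots,N\}$ either $\delta'(x)=0$ for all $x\in I_N^i$, or $\delta'(x)=2$ for all $x\in I_N^i$. For a permutation $\pi$ of $\{1,\dots,N\}$, the equidistant even shuffle $S_\pi:[0,1]\to[0,1]$ is given by $S_\pi(x)=x-\frac{i-\pi(i)}{N}$ for $x\in I_N^i$ (values at grid points are irrelevant), and its copula is $C_{S_\pi}(u,v)=\lambda(\{x\in[0,u]:S_\pi(x)\le v\})$. The permutation $\pi$ (and the shuffle) is called symmetric if $\pi\circ\pi=\mathrm{id}$.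 Put $I_\pi^-:=\{i:\pi(i)<i\}$ and $I_\pi^0:=\{i:\pi(i)=i\}$. $\pi$ is called bi-monotone if its restriction to $I_\pi^-$ is strictly increasing. *)

(* Defs.v *)
From HB Require Import structures.
From mathcomp Require Import all_boot all_order all_algebra all_fingroup.
From mathcomp Require Import all_classical all_reals all_analysis.
Import Order.TTheory GRing.Theory Num.Theory.
Import numFieldNormedType.Exports.

Set Implicit Arguments.
Unset Strict Implicit.
Unset Printing Implicit Defensive.

Local Open Scope classical_set_scope.
Local Open Scope ring_scope.

(* Functions on [0, 1] are represented by functions R -> R, constrained (and
   compared) on [0, 1] only. *)
Record is_diagonal (R : realType) (delta : R -> R) : Prop := IsDiagonal {
  diag_itv : {in `[0, 1], forall t, delta t \in `[0, 1]};
  diag0 : delta 0 = 0;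
  diag1 : delta 1 = 1;
  diag_homo : {in `[0, 1] &, {homo delta : s t / s <= t}};
  diag_lip : 2.-lipschitz_(`[0, 1]) delta;
  diag_le : {in `[0, 1], forall t, delta t <= t}
}.

Definition diag_copula (R : realType) (delta : R -> R) (u v : R) : R :=
  Num.min u (Num.min v ((delta u + delta v) / 2)).

(* Stripes are indexed by 'I_N = {0, ..., N-1}: the i-th stripe in the usual
   1-based numbering is [stripe R (i-1)]. *)
Definition stripe (R : realType) (N : nat) (i : 'I_N) : interval R :=
  `](i%:R / N%:R), (i.+1%:R / N%:R)[.

Definition is_diagonal02 (R : realType) (N : nat) (delta : R -> R) : Prop :=
  is_diagonal delta /\
  forall i : 'I_N,
    {in stripe R i, forall x, is_derive x (1 : R) delta 0} \/
    {in stripe R i, forall x, is_derive x (1 : R) delta 2}.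

(* At grid points, where the value is irrelevant, S(x) = x.
   The offset i - pi(i) does not depend on whether indices start at 0 or 1. *)
Definition shuffle (R : realType) (N : nat) (pi : 'S_N) (x : R) : R :=
  if [pick i : 'I_N | x \in stripe R i] is Some i
  then x - (i%:R - (pi i)%:R) / N%:R
  else x.

Definition shuffle_copula (R : realType) (S : R -> R) (u v : R) : R :=
  fine (lebesgue_measure [set x : R | x \in `[0, u] /\ S x <= v]).

Definition perm_symmetric (N : nat) (pi : 'S_N) : Prop :=
  forall i, pi (pi i) = i.

Definition perm_minus (N : nat) (pi : 'S_N) : {set 'I_N} :=
  [set i | (pi i < i)%N]%SET.

Definition perm_zero (N : nat) (pi : 'S_N) : {set 'I_N} :=
  [set i | pi i == i]%SET.

Definition bimonotone (N : nat) (pi : 'S_N) : Prop :=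
  {in perm_minus pi &, {homo pi : i j / (i < j)%N}}.

(* Main.v *)
Require Import Defs.
From HB Require Import structures.
From mathcomp Require Import all_boot all_order all_algebra all_fingroup.
From mathcomp Require Import all_classical all_reals all_analysis.
From mathcomp Require Import ring lra zify.
Import Order.TTheory GRing.Theory Num.Theory.
Import numFieldNormedType.Exports.
Local Open Scope classical_set_scope.
Local Open Scope ring_scope.

(** Call a stripe rising when delta has slope 2 there, and flat when it has
    slope 0. Since delta vanishes at 0, delta(t)/2 is the length T(t) of the
    rising stripes to the left of t, and F(t) = t - delta(t)/2 is the length
    of the flat stripes to the left of t. The constraint delta(1) = 1 says that
    there are as many rising stripes as flat ones, and delta(t) <= t says that
    T <= F: the word of flat and rising stripes is a ballot word, like flat =
    opening and rising = closing parentheses.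

    The permutation exchanges the k-th rising stripe with the k-th flat stripe
    ([matching_exists]). It is visibly an involution without fixed point that is
    monotone on rising stripes; the ballot condition puts the k-th rising stripe
    to the right of the k-th flat one ([matching_ltn]), so that the stripes
    moved to the left are exactly the rising ones.

    The shuffle S carries the rising stripes onto the flat ones, increasingly
    and without changing lengths, so F(S(x)) = T(x) on rising stripes, and
    symmetrically T(S(x)) = F(x) on flat ones ([occupation_shuffle]). As F is
    strictly increasing across flat stripes, S(x) <= v amounts to T(x) <= F(v)
    for x in a rising stripe ([shuffle_le]). The rising points x <= u with
    S(x) <= v therefore have total length min(T(u), F(v)), and
      C_S(u, v) = min(T(u), F(v)) + min(F(u), T(v))
    ([shuffle_copula_occupation]). For u <= v one has T(u) <= F(u) <= F(v), so
    the right-hand side is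
    T(u) + min(F(u), T(v)) = min(u, (delta(u) + delta(v))/2), which is
    E_delta(u, v) ([diag_copula_occupation]). *)

Set Implicit Arguments.
Unset Strict Implicit.

(** * Matching the stripes of two classes in order *)

Section Ranks.
Context {N : nat} (s : 'I_N -> bool).

(** For a stripe [k] of class [b] this is the position of [k] among the stripes
    of class [b], counted from 0. *)
Definition rank (b : bool) (k : nat) : nat :=
  (\sum_(i < N | s i == b) (i < k))%N.

Lemma rankS b (k : 'I_N) : rank b k.+1 = (rank b k + (s k == b))%N.
Proof.
have ltS (i : 'I_N) : (i < k.+1)%N = ((i < k)%N + (i == k))%N :> nat.
  by rewrite -val_eqE ltnS leq_eqVlt; case: ltngtP.
rewrite /rank (eq_bigr _ (fun i _ => ltS i)).
rewrite big_split /=; congr addn.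
rewrite big_mkcond (bigD1 k) //= eqxx big1 ?addn0; first by case: (s k == b).
by move=> i /negPf ->; case: ifP.
Qed.

Lemma rank0 b : rank b 0 = 0%N.
Proof. by rewrite /rank big1. Qed.

Lemma rankD k : (k <= N)%N -> (rank true k + rank false k)%N = k.
Proof.
elim: k => [|k IH] kN; first by rewrite !rank0.
rewrite !(rankS _ (Ordinal kN)) /= addnACA IH ?(ltnW kN) //.
by case: (s _); rewrite addn1.
Qed.

Lemma leq_rank b j k : (j <= k)%N -> (rank b j <= rank b k)%N.
Proof.
move=> jk; apply: leq_sum => i _.
by case: (ltnP i j) => // ij; rewrite (leq_trans ij jk).
Qed.

Lemma ltn_rank b (j k : 'I_N) : s j = b -> (j < k)%N -> (rank b j < rank b k)%N.
Proof.
move=> sj jk; apply: leq_trans (leq_rank b jk).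
by rewrite rankS sj eqxx addn1.
Qed.

Lemma ltn_rankE b (j k : 'I_N) : s j = b -> s k = b ->
  (rank b j < rank b k)%N = (j < k)%N.
Proof.
move=> sj sk; case: (ltnP j k) => [/(ltn_rank sj) //|kj].
by apply/negbTE; rewrite -leqNgt leq_rank.
Qed.

Lemma rank_inj (j k : 'I_N) : s j = s k -> rank (s j) j = rank (s k) k -> j = k.
Proof.
move=> sjk; rewrite sjk => rjk; apply/val_inj/eqP.
by rewrite eqn_leq leqNgt -(ltn_rankE erefl sjk) rjk ltnn /= leqNgt
  -(ltn_rankE sjk erefl) rjk ltnn.
Qed.

(** A discrete intermediate value theorem: ranks start at 0 and grow by steps of
    at most 1, so every value below the final one is left at some stripe. *)
Lemma rank_surj b c : (c < rank b N)%N ->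
  exists2 i : 'I_N, s i = b & rank b i = c.
Proof.
have: (N <= N)%N by []; elim: {1 3}N => [|n IH] nN; first by rewrite rank0.
rewrite (rankS b (Ordinal nN)) /=.
case: (ltnP c (rank b n)) => [cn _|nc]; first exact: IH (ltnW nN) cn.
case: eqP => [sn|_]; last by rewrite addn0 ltnNge nc.
rewrite addn1 ltnS => cn; exists (Ordinal nN) => //=.
by apply/eqP; rewrite eqn_leq nc cn.
Qed.

(** The classes are exchanged and positions inside a class are kept. Matching
    the k-th stripes with each other (first in, first out) is what makes the
    permutation monotone on each class; nested matching would not. *)
Definition matches (p : 'S_N) :=
  forall i, s (p i) = ~~ s i /\ rank (~~ s i) (p i) = rank (s i) i.

Hypothesis balanced : rank true N = rank false N.

Lemma matching_exists : exists p : 'S_N, matches p.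
Proof.
have mate i : exists j, s j = ~~ s i /\ rank (~~ s i) j = rank (s i) i.
  have lt_rank : (rank (s i) i < rank (~~ s i) N)%N.
    have -> : rank (~~ s i) N = rank (s i) N by case: (s i).
    apply: leq_trans (leq_rank _ (ltn_ord i)).
    by rewrite rankS eqxx addn1.
  by have [j sj rj] := rank_surj lt_rank; exists j.
have [f fP] := choice mate.
have f_inj : injective f.
  move=> i j fij; have [si ri] := fP i; have [sj rj] := fP j.
  have sij : s i = s j by apply: negb_inj; rewrite -si -sj fij.
  by apply: rank_inj => //; rewrite -ri -rj sij fij.
by exists (perm f_inj) => i; rewrite permE.
Qed.

Section Matching.
Variables (p : 'S_N) (pP : matches p).

Lemma matching_invol : perm_symmetric p.
Proof.
move=> i; have [si ri] := pP i; have [ssi rri] := pP (p i).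
have s2 : s (p (p i)) = s i by rewrite ssi si negbK.
by apply: rank_inj => //; rewrite s2 -ri -si -rri si negbK.
Qed.

Hypothesis ballot : forall k, (k <= N)%N -> (rank true k <= rank false k)%N.

(** If [i] is the k-th stripe of class [true], then the ballot condition at the
    right end of [i] provides at least k stripes of class [false] before it, so
    its partner, the k-th of these, lies to its left. The other class follows as
    the matching is an involution. *)
Lemma matching_ltn i : (p i < i)%N = s i.
Proof.
have up_lt j : s j -> (p j < j)%N.
  move=> sj; have [sp rp] := pP j; rewrite sj /= in sp rp.
  (* Applied at [j.+1], not [j]: this is where strictness comes from. *)
  have := ballot (ltn_ord j); rewrite !rankS sj /= addn0 addn1 => lt_r.
  rewrite ltnNge; apply/negP => /(leq_rank false).
  by rewrite rp leqNgt lt_r.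
case si: (s i); first exact: up_lt.
apply/negbTE; rewrite -leqNgt -{1}(matching_invol i) ltnW // up_lt //.
by rewrite (pP i).1 si.
Qed.

Lemma matching_bimonotone : bimonotone p.
Proof.
move=> i j; rewrite !inE !matching_ltn => si sj ij.
have [spi ri] := pP i; have [spj rj] := pP j.
rewrite si /= in spi ri; rewrite sj /= in spj rj.
by rewrite -(ltn_rankE spi spj) ri rj ltn_rankE.
Qed.

Lemma matching_nofix : perm_zero p = finset.set0.
Proof.
apply/setP => i; rewrite !inE; apply/negP => /eqP pi_i.
by have [] := pP i; rewrite pi_i; case: (s i).
Qed.

End Matching.
End Ranks.

(** * Length of a class of stripes below a point *)

Section Occupation.
Context {R : realType} {N : nat} (s : 'I_N -> bool).
Hypothesis N_gt0 : (0 < N)%N.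

(** The length of the part of the [i]-th stripe that lies below [t], in a form
    whose sum over [i] telescopes. *)
Definition overlap (i : nat) (t : R) : R :=
  Num.min t (i.+1%:R / N%:R) - Num.min t (i%:R / N%:R).

(** With [s] marking the rising stripes, [occupation true] is the function T and
    [occupation false] the function F of the introduction. *)
Definition occupation (b : bool) (t : R) : R :=
  \sum_(i < N | s i == b) overlap i t.

Lemma grid_le (j k : nat) : (j%:R / N%:R <= k%:R / N%:R :> R) = (j <= k)%N.
Proof. by rewrite ler_pM2r ?invr_gt0 ?ltr0n // ler_nat. Qed.

Lemma gridS (i : nat) : i.+1%:R / N%:R = i%:R / N%:R + N%:R^-1 :> R.
Proof. by rewrite -natr1 mulrDl mul1r. Qed.

Lemma invN_gt0 : 0 < N%:R^-1 :> R.
Proof. by rewrite invr_gt0 ltr0n. Qed.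

Lemma overlap_homo i : {homo overlap i : x y / x <= y}.
Proof.
move=> x y xy; rewrite /overlap gridS; have N0 := invN_gt0.
by rewrite !minElt; do 4 case: ltP => ?; lra.
Qed.

Lemma ltr_overlap (i : 'I_N) (x y : R) : x \in stripe R i -> y < x ->
  overlap i y < overlap i x.
Proof.
rewrite /stripe in_itv /= /overlap gridS => /andP[ix xi] yx.
have N0 := invN_gt0; rewrite ltNge; apply/negP.
by rewrite !minElt; do 4 case: ltP => ?; lra.
Qed.

Lemma overlap_grid i k : overlap i (k%:R / N%:R) = (i < k)%:R / N%:R.
Proof.
rewrite /overlap; case: (ltnP i k) => ik.
  rewrite !min_r ?grid_le ?(ltnW ik) // gridS.
  by rewrite addrAC subrr add0r mul1r.
by rewrite !min_l ?grid_le ?(leqW ik) // subrr mul0r.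
Qed.

Lemma overlap_in_stripe i k (t : R) : k%:R / N%:R <= t <= k.+1%:R / N%:R ->
  overlap i t = overlap i (k%:R / N%:R) + (i == k)%:R * (t - k%:R / N%:R).
Proof.
move=> /andP[kt tk]; rewrite overlap_grid /overlap.
case: (ltngtP i k) => [ik|ki|->] /=.
- rewrite !min_r ?gridS; first ring.
    by apply: le_trans kt; rewrite grid_le ltnW.
  by rewrite -gridS; apply: le_trans kt; rewrite grid_le.
- rewrite !min_l; first ring.
    by apply: (le_trans tk); rewrite grid_le.
  by apply: (le_trans tk); rewrite grid_le leqW.
- by rewrite min_l // min_r //; ring.
Qed.

Lemma occupation_homo b : {homo occupation b : x y / x <= y}.
Proof. by move=> x y xy; apply: ler_sum => i _; apply: overlap_homo. Qed.

Lemma occupation0 b : occupation b 0 = 0.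
Proof.
by apply: big1 => i _; have := overlap_grid i 0; rewrite mulr0n !mul0r.
Qed.

(** Only the first point has to lie inside a stripe of the class: if
    [y < x], then the part of that very stripe between [y] and [x] is lost. *)
Lemma occupation_le (i : 'I_N) (x y : R) : x \in stripe R i ->
  (occupation (s i) x <= occupation (s i) y) = (x <= y).
Proof.
move=> xi; case: (leP x y) => [/occupation_homo -> //|yx].
apply/negbTE; rewrite -ltNge /occupation !(bigD1 i (eqxx (s i))) /=.
apply: ltr_leD; first exact: ltr_overlap.
by apply: ler_sum => j _; apply/overlap_homo/ltW.
Qed.

Lemma occupation_grid b k : occupation b (k%:R / N%:R) = (rank s b k)%:R / N%:R.
Proof.
rewrite /occupation /rank natr_sum mulr_suml.
by apply: eq_bigr => i _; rewrite overlap_grid.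
Qed.

Lemma occupation_in_stripe b (k : 'I_N) (t : R) :
  k%:R / N%:R <= t <= k.+1%:R / N%:R ->
  occupation b t = (rank s b k)%:R / N%:R + (s k == b)%:R * (t - k%:R / N%:R).
Proof.
move=> kt; rewrite -occupation_grid /occupation.
rewrite (eq_bigr _ (fun (i : 'I_N) _ => overlap_in_stripe i kt)) big_split /=.
congr +%R; rewrite -mulr_suml; congr *%R.
rewrite big_mkcond (bigD1 k) //= eqxx big1 ?addr0; first by case: (s k == b).
by move=> i /negPf ik; rewrite -[(_ == _ :> nat)]/(i == k) ik; case: ifP.
Qed.

Lemma occupationD (t : R) : t \in `[0, 1] ->
  occupation true t + occupation false t = t.
Proof.
rewrite in_itv /= => /andP[t0 t1].
pose g (i : nat) : R := Num.min t (i%:R / N%:R).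
transitivity (\sum_(i < N) (g i.+1 - g i)).
  rewrite [RHS](bigID (fun i => s i == true)) /=; congr +%R.
  by apply: eq_bigl => i; case: (s i).
rewrite -(big_mkord xpredT (fun i => g i.+1 - g i)) telescope_sumr //.
by rewrite /g divff ?pnatr_eq0 -?lt0n // mul0r min_l // min_r // subr0.
Qed.

Lemma occupation_itv b (t : R) : t \in `[0, 1] -> occupation b t \in `[0, 1].
Proof.
move=> t01; have := occupationD t01; move: t01.
rewrite !in_itv /= => /andP[t0 t1].
have := occupation_homo true t0; have := occupation_homo false t0.
by rewrite !occupation0; case: b; lra.
Qed.

(** Both occupation functions are non-decreasing and they add up to the
    identity, so neither can grow faster than the identity. *)
Lemma occupation_lip b : {in `[0, 1] &, forall x y,
  `|occupation b x - occupation b y| <= 1 * `|x - y|}.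
Proof.
have mon (x y : R) : x \in `[0, 1] -> y \in `[0, 1] -> x <= y ->
    `|occupation b x - occupation b y| <= 1 * `|x - y|.
  move=> x01 y01 xy; have := occupationD x01; have := occupationD y01.
  have hT := occupation_homo true xy; have hF := occupation_homo false xy.
  rewrite mul1r distrC (distrC x) !ger0_norm ?subr_ge0 ?occupation_homo //.
  by case: b; lra.
move=> x y x01 y01; case: (leP x y) => [|/ltW] xy; first exact: mon.
by rewrite distrC [in leRHS]distrC mon.
Qed.

End Occupation.

(** * Continuity and truncation of real functions *)

Lemma lipschitz_within_continuous {R : realType} (k : R) (A : set R)
    (f : R -> R) :
  0 < k -> (forall x y, A x -> A y -> `|f x - f y| <= k * `|x - y|) ->
  {within A, continuous f}.
Proof.
move=> k0 fk; apply/subspace_continuousP => x Ax.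
apply/cvgrPdist_le => e e0.
rewrite near_withinE; near=> y => Ay.
apply: le_trans (fk _ _ Ax Ay) _.
rewrite mulrC -ler_pdivlMr //; near: y.
by apply: cvgr_dist_le; [exact: cvg_id|exact: divr_gt0].
Unshelve. all: by end_near. Qed.

Lemma IVT_truncate {R : realType} (f : R -> R) (u c : R) : 0 <= u -> f 0 = 0 ->
  0 <= f u -> 0 <= c -> {within `[0, u], continuous f} ->
  exists2 w, w \in `[0, u] & f w = Num.min (f u) c.
Proof.
move=> u0 f0 fu c0 cf; apply: IVT => //.
by rewrite f0 min_l // max_r // le_min fu c0 ge_min lexx.
Qed.

(** * Diagonals with slopes 0 and 2 *)

Section Diagonal.
Context {R : realType} {N : nat} (delta : R -> R).
Hypothesis N_gt0 : (0 < N)%N.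
Hypothesis delta02 : is_diagonal02 N delta.

Definition rises (i : 'I_N) : bool :=
  `[< {in stripe R i, forall x, is_derive x (1 : R) delta 2} >].

Lemma rises_derive i x : x \in stripe R i ->
  is_derive x (1 : R) delta (2 * (rises i)%:R).
Proof.
move=> xi; rewrite /rises; case: asboolP => [/(_ x xi)|ri].
  by rewrite mulr1.
by case: (delta02.2 i) => // /(_ x xi); rewrite mulr0.
Qed.

Lemma stripe_sub (i : 'I_N) (t : R) :
  i%:R / N%:R <= t <= i.+1%:R / N%:R -> t \in `[(0:R), 1].
Proof.
move=> /andP[it ti]; rewrite in_itv /=; apply/andP; split.
  by apply: le_trans it; rewrite divr_ge0.
by apply: (le_trans ti); rewrite ler_pdivrMr ?ltr0n // mul1r ler_nat.
Qed.

Lemma diagonal_lip : {in `[0, 1] &, forall x y,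
  `|delta x - delta y| <= 2 * `|x - y|}.
Proof.
move=> x y x01 y01.
exact: (diag_lip delta02.1 (conj x01 y01 : (_ `*` _) (x, y))).
Qed.

(** The derivative is only known inside the stripe; the Lipschitz bound supplies
    the continuity at its end points that the mean value theorem needs. *)
Lemma diagonal_in_stripe (i : 'I_N) (t : R) :
  i%:R / N%:R <= t <= i.+1%:R / N%:R ->
  delta t = delta (i%:R / N%:R) + 2 * (rises i)%:R * (t - i%:R / N%:R).
Proof.
move=> it; have := it => /andP[i_t ti].
have sub x : x \in `[i%:R / N%:R, t] -> x \in `[(0:R), 1].
  rewrite in_itv /= => /andP[ix xt]; apply: (@stripe_sub i).
  by rewrite ix (le_trans xt ti).
have [||c _ /eqP] := @MVT_segment R delta (fun=> 2 * (rises i)%:R) _ _ i_t.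
- move=> x; rewrite in_itv /= => /andP[ix xt]; apply: rises_derive.
  by rewrite /stripe in_itv /= ix (lt_le_trans xt ti).
- apply: (@lipschitz_within_continuous _ 2) => // x y /= x01 y01.
  by apply: diagonal_lip; apply: sub.
- by rewrite subr_eq addrC => /eqP.
Qed.

(** Both sides vanish at 0 and are affine with the same slope on each closed
    stripe: the stripes are added one at a time. *)
Lemma diagonal_occupation (t : R) : t \in `[0, 1] ->
  delta t = 2 * occupation rises true t.
Proof.
have upto k : (k <= N)%N -> forall t, 0 <= t <= k%:R / N%:R ->
    delta t = 2 * occupation rises true t.
  elim: k => [|k IH] kN {}t /andP[t0 tk].
    have -> : t = 0.
      by apply/eqP; rewrite eq_le t0 andbT; rewrite mulr0n mul0r in tk.
    by rewrite (diag0 delta02.1) occupation0 // mulr0.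
  case: (leP t (k%:R / N%:R)) => kt.
    by apply: IH; rewrite ?t0 // (ltnW kN).
  have st : (Ordinal kN)%:R / N%:R <= t <= (Ordinal kN).+1%:R / N%:R.
    by rewrite tk ltW.
  rewrite (diagonal_in_stripe st) (occupation_in_stripe rises N_gt0 true st).
  have IHk : delta (k%:R / N%:R) = 2 * occupation rises true (k%:R / N%:R).
    by apply: IH; rewrite ?(ltnW kN) // lexx andbT divr_ge0.
  rewrite -occupation_grid // IHk.
  by case: (rises _); rewrite /= ?eqxx; ring.
rewrite in_itv /= => t01; apply: (upto N) => //.
by rewrite divff ?pnatr_eq0 -?lt0n.
Qed.

Lemma rank_rises_ballot k : (k <= N)%N ->
  (rank rises true k <= rank rises false k)%N.
Proof.
move=> kN; have k01 : k%:R / N%:R \in `[(0 : R), 1].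
  by rewrite in_itv /= divr_ge0 //= ler_pdivrMr ?ltr0n // mul1r ler_nat.
have := diag_le delta02.1 k01.
rewrite diagonal_occupation // occupation_grid // mulrA.
rewrite ler_pM2r ?invr_gt0 ?ltr0n // -natrM ler_nat.
by have := rankD rises kN; lia.
Qed.

Lemma rank_rises_balanced : rank rises true N = rank rises false N.
Proof.
have : delta (N%:R / N%:R) = 1.
  by rewrite divff ?pnatr_eq0 -?lt0n // (diag1 delta02.1).
rewrite diagonal_occupation ?occupation_grid //; last first.
  by rewrite divff ?pnatr_eq0 -?lt0n // in_itv /= ler01 lexx.
rewrite mulrA => /divr1_eq /eqP; rewrite -natrM eqr_nat => /eqP.
by have := rankD rises (leqnn N); lia.
Qed.

(** Both sides are symmetric in [u] and [v]. For [u <= v], the inequality T <= F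
    collapses the first minimum to T(u). *)
Lemma diag_copula_occupation (u v : R) : u \in `[0, 1] -> v \in `[0, 1] ->
  diag_copula delta u v =
  Num.min (occupation rises true u) (occupation rises false v) +
  Num.min (occupation rises false u) (occupation rises true v).
Proof.
wlog uv : u v / u <= v => [wlog_uv|] u01 v01.
  case: (leP u v) => [|/ltW] uv; first exact: wlog_uv.
  rewrite addrC minC [X in _ + X]minC -wlog_uv //.
  by rewrite /diag_copula !minA (minC u) (addrC (delta u)).
have := diag_le delta02.1 u01; have := diag_le delta02.1 v01.
rewrite /diag_copula !diagonal_occupation //.
have := occupationD rises N_gt0 u01; have := occupationD rises N_gt0 v01.
have := occupation_homo rises N_gt0 true uv.
have := occupation_homo rises N_gt0 false uv.
set Tu := occupation rises true u; set Fu := occupation rises false u.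
set Tv := occupation rises true v; set Fv := occupation rises false v.
move=> Fuv Tuv vE uE dv du.
have -> : (2 * Tu + 2 * Tv) / 2 = Tu + Tv by field.
rewrite (min_l (_ : Tu <= Fv)); last lra.
rewrite minA (min_l uv) -uE.
by rewrite !minElt; case: ltP => ?; case: ltP => ?; lra.
Qed.

End Diagonal.

(** * The copula of the shuffle *)

Section ShuffleCopula.
Context {R : realType} {N : nat} (s : 'I_N -> bool) (p : 'S_N).
Hypothesis N_gt0 : (0 < N)%N.
Hypothesis pP : matches s p.

Lemma stripe_inj (i j : 'I_N) (x : R) :
  x \in stripe R i -> x \in stripe R j -> i = j.
Proof.
rewrite /stripe !in_itv /= => /andP[ix xi] /andP[jx xj].
have := lt_trans ix xj; have := lt_trans jx xi.
rewrite !ltr_pM2r ?invr_gt0 ?ltr0n // !ltr_nat !ltnS => ji ij.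
by apply/val_inj/eqP; rewrite eqn_leq ij ji.
Qed.

Lemma shuffleE (i : 'I_N) (x : R) : x \in stripe R i ->
  shuffle p x = x - (i%:R - (p i)%:R) / N%:R.
Proof.
move=> xi; rewrite /shuffle; case: pickP => [j xj|/(_ i)]; last by rewrite xi.
by rewrite (stripe_inj xj xi).
Qed.

Lemma shuffle_stripe (i : 'I_N) (x : R) : x \in stripe R i ->
  shuffle p x \in stripe R (p i).
Proof.
move=> xi; rewrite (shuffleE xi); move: xi; rewrite /stripe !in_itv /= !gridS.
by rewrite mulrBl; lra.
Qed.

Lemma stripe_closed (i : 'I_N) (x : R) : x \in stripe R i ->
  i%:R / N%:R <= x <= i.+1%:R / N%:R.
Proof. by rewrite /stripe in_itv /= => /andP[/ltW -> /ltW ->]. Qed.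

(** A stripe and its partner have the same rank in their classes, so the same
    length of the respective class precedes them, and the shuffle translates one
    onto the other. *)
Lemma occupation_shuffle (i : 'I_N) (x : R) : x \in stripe R i ->
  occupation s (~~ s i) (shuffle p x) = occupation s (s i) x.
Proof.
move=> xi; have [sp rp] := pP i.
rewrite (occupation_in_stripe s N_gt0 _ (stripe_closed (shuffle_stripe xi))).
rewrite (occupation_in_stripe s N_gt0 _ (stripe_closed xi)) rp sp !eqxx.
by rewrite (shuffleE xi); ring.
Qed.

Lemma shuffle_le (i : 'I_N) (x v : R) : x \in stripe R i ->
  (shuffle p x <= v) = (occupation s (s i) x <= occupation s (~~ s i) v).
Proof.
move=> xi; rewrite -(occupation_shuffle xi) -(pP i).1.
by rewrite (occupation_le s N_gt0) // shuffle_stripe.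
Qed.

Lemma lebesgue_stripe_le (i : 'I_N) (t : R) :
  lebesgue_measure ([set` stripe R i] `&` [set` `]-oo, t]]) =
  (@overlap R N i t)%:E.
Proof.
rewrite /overlap; case: (ltP t (i.+1%:R / N%:R)) => ti.
  have -> : [set` stripe R i] `&` [set` `]-oo, t]] = [set` `]i%:R / N%:R, t]].
    apply/seteqP; split => x; rewrite /= !in_itv /=.
      by move=> [/andP[-> _] ->].
    by move=> /andP[ix xt]; rewrite ix xt (le_lt_trans xt ti).
  rewrite lebesgue_measure_itv /= lte_fin; case: ltP => it.
    by rewrite EFinB.
  by rewrite subrr.
have it : i%:R / N%:R <= t by apply: le_trans ti; rewrite grid_le.
have -> : [set` stripe R i] `&` [set` `]-oo, t]] = [set` stripe R i].
  apply: setIidl => x; rewrite /= !in_itv /= => /andP[_ xi].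
  exact: le_trans (ltW xi) ti.
rewrite lebesgue_measure_itv /= lte_fin min_r // EFinB ifT //.
by rewrite gridS ltrDl invN_gt0.
Qed.

Lemma off_stripes_countable (A : set R) : A `<=` [set` `[0, 1]] ->
  (forall x, A x -> forall i : 'I_N, x \notin stripe R i) -> countable A.
Proof.
move=> A01 Aoff; pose grid (k : nat) : R := k%:R / N%:R.
apply: (@sub_countable _ _ _ (grid @` setT)); last first.
  by apply: sub_countable (card_image_le _ _) _; exact: countableP.
apply: subset_card_le => x Ax.
have := A01 x Ax; rewrite /= in_itv /= => /andP[x0 x1].
have NR : 0 < N%:R :> R by rewrite ltr0n.
have := truncn_itv (mulr_ge0 x0 (ltW NR)).
set k := Num.truncn _ => /andP[kx xk].
exists k => //; rewrite /grid; apply/eqP; rewrite eq_le ler_pdivrMr // kx /=.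
rewrite leNgt; apply/negP => lt_kx.
have kN : (k < N)%N.
  rewrite -(ltr_nat R); have : k%:R < x * N%:R by rewrite -ltr_pdivrMr.
  by move/lt_le_trans; apply; rewrite ler_piMl // ltW.
have /negP := Aoff x Ax (Ordinal kN); apply.
by rewrite /stripe in_itv /= lt_kx ltr_pdivlMr.
Qed.

(** Cutting a class at [w] realizes the constraint that the occupation be at most
    [c] as a constraint on the point itself. *)
Lemma occupation_level b (u c : R) : u \in `[0, 1] -> 0 <= c ->
  exists2 w, w \in `[0, u] & occupation s b w = Num.min (occupation s b u) c.
Proof.
move=> u01 c0; have := u01; rewrite in_itv /= => /andP[u0 u1].
apply: IVT_truncate => //; first exact: occupation0.
  by have := occupation_itv s N_gt0 b u01; rewrite in_itv /= => /andP[].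
have sub x : x \in `[0, u] -> x \in `[(0 : R), 1].
  by rewrite !in_itv /= => /andP[-> /le_trans ->].
apply: (@lipschitz_within_continuous _ 1) => // x y /= x0u y0u.
by apply: occupation_lip => //; apply: sub.
Qed.

(** Up to countably many points, the set measured by the copula is the union of
    the stripes of each class [b] cut at a level [w b], at which the occupation
    of that class equals the corresponding minimum. *)
Lemma shuffle_copula_occupation (u v : R) : u \in `[0, 1] -> v \in `[0, 1] ->
  shuffle_copula (shuffle p) u v =
  Num.min (occupation s true u) (occupation s false v) +
  Num.min (occupation s false u) (occupation s true v).
Proof.
move=> u01 v01.
have cut b : exists w, w \in `[0, u] /\
    occupation s b w = Num.min (occupation s b u) (occupation s (~~ b) v).
  have := occupation_itv s N_gt0 (~~ b) v01; rewrite in_itv /= => /andP[v0 _].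
  by have [w w0u wE] := occupation_level b u01 v0; exists w.
have [w wP] := choice cut.
pose E (i : 'I_N) : set R := [set` stripe R i] `&` [set` `]-oo, w (s i)]].
have mE i : measurable (E i) by apply: measurableI; exact: measurable_itv.
have tE : trivIset setT E.
  apply/trivIsetP => i j _ _ /eqP ij; apply/seteqP.
  by split => // x [[xi _] [xj _]]; have := stripe_inj xi xj.
pose A := [set x : R | x \in `[0, u] /\ shuffle p x <= v].
have AE (i : 'I_N) x : x \in stripe R i -> A x <-> x <= w (s i).
  move=> xi; have [w0u wE] := wP (s i).
  have x01 := stripe_sub N_gt0 (stripe_closed xi).
  move: u01 w0u x01; rewrite /A /= !in_itv /= (shuffle_le _ xi).
  move=> /andP[u0 u1] /andP[w0 wu] /andP[x0 x1]; rewrite x0 /=.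
  rewrite -(occupation_le s N_gt0 (w (s i)) xi) wE le_min.
  rewrite (occupation_le s N_gt0 _ xi).
  by split => [[-> ->]|/andP[]].
(* What is left of [A] consists of grid points. *)
have A_split : A = \big[setU/set0]_(i < N) E i `|`
    (A `\` \big[setU/set0]_(i < N) E i).
  rewrite setDE setUIr setUv setIT; apply/esym/setUidr.
  rewrite -bigcup_seq => x [i _ [xi xw]]; apply/(AE i x xi).
  by move: xw; rewrite /= in_itv.
have G_countable : countable (A `\` \big[setU/set0]_(i < N) E i).
  apply: off_stripes_countable => [x [[]]|x [Ax nE] i].
    by move: u01; rewrite /= !in_itv /= => /andP[_ u1] /andP[-> /le_trans ->].
  apply/negP => xi; apply: nE; rewrite -bigcup_seq.
  exists i; first by rewrite /= mem_index_enum.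
  by split=> //; rewrite /= in_itv /=; apply/(AE i x xi).
have muA : lebesgue_measure A = (\sum_(i < N) lebesgue_measure (E i))%E.
  rewrite A_split measureU0.
  - exact: (measure_bigsetU_ord (@lebesgue_measure R) xpredT mE tE).
  - by apply: bigsetU_measurable => i _; exact: mE.
  - exact: countable_measurable.
  - exact: countable_lebesgue_measure0.
rewrite /shuffle_copula -/A muA.
rewrite (eq_bigr _ (fun i _ => lebesgue_stripe_le i (w (s i)))) sumEFin /=.
rewrite (bigID (fun i => s i == true)) /=; congr +%R.
  by rewrite -(wP true).2; apply: eq_bigr => i /eqP ->.
rewrite -(wP false).2; apply: eq_big => i; first by case: (s i).
by case: (s i).
Qed.

End ShuffleCopula.

Theorem theorem3p7 (R : realType) (N : nat) (delta : R -> R)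
    (N_gt0 : (0 < N)%N) (N_even : ~~ odd N)
    (delta02 : is_diagonal02 N delta) :
  exists pi : 'S_N,
    [/\ {in `[0, 1] &, forall u v : R,
           diag_copula delta u v = shuffle_copula (shuffle pi) u v},
        perm_symmetric pi,
        bimonotone pi &
        perm_zero pi = finset.set0].
Proof.
have [p pP] := matching_exists (rank_rises_balanced N_gt0 delta02).
have ballot := rank_rises_ballot N_gt0 delta02.
exists p; split.
- move=> u v u01 v01.
  rewrite (diag_copula_occupation N_gt0 delta02 u01 v01).
  by rewrite (shuffle_copula_occupation N_gt0 pP u01 v01).
- exact: matching_invol pP.
- exact: matching_bimonotone pP ballot.
- exact: matching_nofix pP.
Qed.
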